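(* Let $\mathcal{A}\subseteq P(\mathbb{N})$ be an almost disjoint family. The following assertions are equivalent. (1) $\Psi(\mathcal{A})$ has the star-Scheepers property. (2) For each function $A\mapsto f_A$ from $\mathcal{A}$ to $\mathbb{N}^{\mathbb{N}}$ there are finite sets $\mathcal{F}_1,\mathcal{F}_2,\ldots\subseteq\mathcal{A}$ such that for each finite set $\mathcal{F}\subseteq\mathcal{A}$ there exists $n$ such that $$(A\setminus f_A(n))\cap\bigcup_{B\in\mathcal{F}_n}(B\setminus f_B(n))\neq\emptyset\quad\text{for all }A\in\mathcal{F}.$$
   Context: A family $\mathcal{A}\subseteq P(\mathbb{N})$ is almost disjoint if every $A\in\mathcal{A}$ is infinite and $B\cap C$ is finite for distinct $B,C\in\mathcal{A}$ (maximality is not required). The Isbell-Mrówka space is $\Psi(\mathcal{A})=\mathcal{A}\cup\mathbb{N}$, where points of $\mathbb{N}$ are isolated and basic neighbourhoods of $A\in\mathcal{A}$ are the sets $\{A\}\cup(A\setminus F)$ with $F\subseteq\mathbb{N}$ finite. In expressions such as $A\setminus m$ with $m\in\mathbb{N}$, the number $m$ is identified with the set of smaller natural numbers, i.e. $A\setminus m=\{k\in A : k\geq m\}$. For $A\subseteq X$ and a family $\mathcal{P}$ of subsets of $X$, $St(A,\mathcal{P})=\bigcup\{B\in\mathcal{P} : A\cap B\neq\emptyset\}$. An $\omega$-cover of $X$ is an open cover $\mathcal{U}$ such that every finite $F\subseteq X$ is contained in some member of $\mathcal{U}$. $X$ is star-Scheepers if for each sequence $(\mathcal{U}_n)_{n\in\mathbb{N}}$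 of open covers of $X$ there are finite $\mathcal{V}_n\subseteq\mathcal{U}_n$ such that $\{St(\bigcup\mathcal{V}_n,\mathcal{U}_n) : n\in\mathbb{N}\}$ is an $\omega$-cover of $X$ or $St(\bigcup\mathcal{V}_n,\mathcal{U}_n)=X$ for some $n$. *)

(* Defs.v *)
From HB Require Import structures.
From mathcomp Require Import all_boot.
From mathcomp Require Import all_classical.
From mathcomp Require Import topology.

Set Implicit Arguments.
Unset Strict Implicit.
Unset Printing Implicit Defensive.

Local Open Scope classical_set_scope.

Definition almost_disjoint (AA : set (set nat)) : Prop :=
  (forall A, AA A -> infinite_set A) /\
  (forall B C, AA B -> AA C -> B <> C -> finite_set (B `&` C)).

(* [AA], used as a type, is the type of members of [AA]; a point [A : AA] is
   turned into the underlying set of naturals by [set_val]. *)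
Inductive Psi (AA : set (set nat)) : Type :=
| psi_set of AA
| psi_nat of nat.

Arguments psi_set {AA} _.
Arguments psi_nat {AA} _.

HB.instance Definition _ (AA : set (set nat)) := gen_eqMixin (Psi AA).
HB.instance Definition _ (AA : set (set nat)) := gen_choiceMixin (Psi AA).

Section PsiTopology.
Variable AA : set (set nat).

Definition psi_basic (A : AA) (F : set nat) : set (Psi AA) :=
  psi_set A |` psi_nat @` (set_val A `\` F).

Definition psi_base : set (set (Psi AA)) :=
  [set W | (exists n, W = [set psi_nat n]) \/
           (exists A F, finite_set F /\ W = psi_basic A F)].

Lemma psi_base_cover : \bigcup_(W in psi_base) W = setT.
Proof.
rewrite -subTset => -[A|n] _.
  exists (psi_basic A set0); last by left.
  by right; exists A, set0; split => //; exact: finite_set0.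
by exists [set psi_nat n] => //; left; exists n.
Qed.

Lemma psi_base_join (U V : set (Psi AA)) (x : Psi AA) :
  psi_base U -> psi_base V -> U x -> V x ->
  exists W, [/\ psi_base W, W x & W `<=` U `&` V].
Proof.
case: x => [A|n] UB VB Ux Vx; last first.
  exists [set psi_nat n]; split => //; first by left; exists n.
  by move=> _ ->.
have pick (W : set (Psi AA)) : psi_base W -> W (psi_set A) ->
    exists2 F, finite_set F & W = psi_basic A F.
  move=> [[n ->] //|[B [F [finF ->]]]] [[<-]|[? _ //]].
  by exists F.
have [F finF ->] := pick U UB Ux.
have [G finG ->] := pick V VB Vx.
exists (psi_basic A (F `|` G)); split.
- by right; exists A, (F `|` G); rewrite finite_setU.
- by left.
- move=> y [->|[k [Ak FGk] <-]]; first by split; left.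
  by split; right; exists k => //; split => // ?; apply: FGk; [left|right].
Qed.

HB.instance Definition _ := @isBaseTopological.Build (Psi AA)
  (set (Psi AA)) psi_base id psi_base_cover psi_base_join.

Lemma open_PsiE (U : set (Psi AA)) :
  open U <-> forall A, U (psi_set A) ->
    exists2 F, finite_set F & psi_basic A F `<=` U.
Proof.
split.
  move=> [D DB <-] A [W DW WA].
  have [[n WE]|[B [F [finF WE]]]] := DB _ DW; first by rewrite WE in WA.
  move: WA; rewrite /= WE => -[[AB]|[? _ //]].
  exists F => // y; rewrite AB => By; exists W => //.
  by rewrite /= WE.
move=> UP; exists [set W | psi_base W /\ W `<=` U]; first by move=> W [].
apply/seteqP; split => [x [W [_ WU] Wx]|[A|n] Ux]; first exact: WU.
  have [F finF FU] := UP A Ux.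
  exists (psi_basic A F); last by left.
  by split => //; right; exists A, F.
exists [set psi_nat n] => //; split; first by left; exists n.
by move=> _ ->.
Qed.

End PsiTopology.

Definition star (X : Type) (A : set X) (P : set (set X)) : set X :=
  \bigcup_(B in [set B | P B /\ A `&` B !=set0]) B.

Definition open_cover (X : topologicalType) (U : set (set X)) : Prop :=
  U `<=` open /\ cover U id = setT.

Definition omega_cover (X : topologicalType) (U : set (set X)) : Prop :=
  open_cover U /\ forall F : set X, finite_set F -> exists2 W, U W & F `<=` W.

Definition star_Scheepers (X : topologicalType) : Prop :=
  forall U : nat -> set (set X), (forall n, open_cover (U n)) ->
  exists V : nat -> set (set X),
    (forall n, finite_set (V n) /\ V n `<=` U n) /\
    (omega_cover [set star (\bigcup_(W in V n) W) (U n) | n in [set: nat]] \/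
     exists n, star (\bigcup_(W in V n) W) (U n) = setT).

(* [A \ m], the number [m] being the set of smaller naturals. *)
Definition cut (A : set nat) (m : nat) : set nat := A `\` `I_m.

(* Main.v *)
Require Import Defs.
From mathcomp Require Import all_boot.
From mathcomp Require Import all_classical.
From mathcomp Require Import topology.

(** For (1) => (2), apply the star-Scheepers property to the covers by the sets
    {A} u (A \ f_A(n)) and the singletons {k}; a selected singleton {k} is
    traded for one A with k in A \ f_A(n), if there is any.
    For (2) => (1), every open cover is refined at the points of the family by
    such sets, but a witness n given by (2) may be too small for the selected
    sets to cover the isolated points of a given finite set. So (2) is applied
    to all the shifts n |-> f_A(n + j), and the n-th selection collects the
    families that the shifts j < n assign to n - j: using the shift j = m then
    yields a witness above m. *)

Local Open Scope classical_set_scope.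

Lemma finite_set_nat_bounded (F : set nat) :
  finite_set F -> exists m, F `<=` `I_m.
Proof.
move=> /finite_seqP[s ->]; exists (\max_(i <- s) i).+1 => i /= si.
by rewrite ltnS; exact: (@leq_bigmax_seq _ _ _ id).
Qed.

Lemma subset_star (X : Type) (A B : set X) (P : set (set X)) :
  P B -> A `&` B !=set0 -> B `<=` star A P.
Proof. by move=> PB AB x Bx; exists B. Qed.

Lemma open_star (X : topologicalType) (A : set X) (P : set (set X)) :
  P `<=` open -> open (star A P).
Proof. by move=> Po; apply: bigcup_open => B [/Po]. Qed.

Lemma omega_coverP (X : topologicalType) (U : set (set X)) :
  U `<=` open -> (forall F, finite_set F -> exists2 W, U W & F `<=` W) ->
  omega_cover U.
Proof.
move=> Uo Uf; split=> //; split=> //; rewrite -subTset => x _.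
have [W UW xW] := Uf [set x] (finite_set1 x).
by exists W => //; apply: xW.
Qed.

Section PsiCovers.
Context {AA : set (set nat)}.

Lemma open_psi_basic (A : AA) (F : set nat) :
  finite_set F -> open (psi_basic A F).
Proof.
move=> finF; apply/open_PsiE => B [[<-]|[? _ //]].
by exists F.
Qed.

Lemma open_psi_nat (k : nat) : open [set @psi_nat AA k].
Proof. by apply/open_PsiE => A. Qed.

Lemma open_Psi_cut (U : set (Psi AA)) (A : AA) :
  open U -> U (psi_set A) -> exists m, psi_basic A `I_m `<=` U.
Proof.
move=> /open_PsiE Uo /Uo[F finF FU].
have [m Fm] := finite_set_nat_bounded _ finF.
exists m; apply: subset_trans FU; apply: setUS; apply: image_subset.
exact: setDS.
Qed.

Definition cut_cover (h : AA -> nat) : set (set (Psi AA)) :=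
  [set W | (exists A, W = psi_basic A `I_(h A)) \/
           (exists k, W = [set psi_nat k])].

Lemma cut_cover_open_cover (h : AA -> nat) : open_cover (cut_cover h).
Proof.
split=> [W [[A ->]|[k ->]]|].
- exact/open_psi_basic/finite_II.
- exact: open_psi_nat.
- rewrite -subTset => -[A|k] _.
    by exists (psi_basic A `I_(h A)); [left; exists A|left].
  by exists [set psi_nat k]; [right; exists k|].
Qed.

Lemma psi_basic_set (A B : AA) (F : set nat) :
  psi_basic A F (psi_set B) -> A = B.
Proof. by move=> [[]|[]]. Qed.

Lemma psi_basic_nat (A : AA) (F : set nat) (k : nat) :
  psi_basic A F (psi_nat k) -> (set_val A `\` F) k.
Proof. by move=> [//|[l Al [<-]]]. Qed.

(** A basic set in the cover is determined by its one point of the family, and a singleton by its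
    number, so a finite [V] involves only finitely many of either. Infiniteness of the members of
    [AA] makes every cut nonempty. *)
Lemma cut_cover_star (h : AA -> nat) (V : set (set (Psi AA))) :
  (forall A, AA A -> infinite_set A) ->
  finite_set V -> V `<=` cut_cover h ->
  exists2 F : set AA, finite_set F &
    forall A, star (\bigcup_(W in V) W) (cut_cover h) (psi_set A) ->
      cut (set_val A) (h A) `&`
      \bigcup_(B in F) cut (set_val B) (h B) !=set0.
Proof.
move=> infA finV VU.
have cut_neq0 A : cut (set_val A) (h A) !=set0.
  apply/set0P/eqP => cut0; suff : infinite_set (cut (set_val A) (h A)).
    by rewrite cut0; apply.
  by apply: infinite_setD; [exact/infA/set_valP|exact: finite_II].
(* Infinitely many cuts may contain [k]; keeping at most one of them keeps [F2] finite. *)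
pose c k : set AA := if pselect (exists A, cut (set_val A) (h A) k) is left e
  then [set projT1 (cid e)] else set0.
have c_ex A k : cut (set_val A) (h A) k ->
    exists2 B, c k B & cut (set_val B) (h B) k.
  move=> Ak; rewrite /c; case: pselect => [e|[]]; last by exists A.
  by exists (projT1 (cid e)) => //; exact: (projT2 (cid e)).
pose F1 := (fun B => psi_basic B `I_(h B)) @^-1` V.
pose F2 := \bigcup_(k in (fun k => [set psi_nat k]) @^-1` V) c k.
exists (F1 `|` F2).
  rewrite finite_setU; split.
    apply: finite_preimage => // A B _ _ AB.
    apply/esym/(psi_basic_set _ _ `I_(h B)).
    by rewrite -AB; left.
  apply: bigcup_finite => [|k _].
    apply: finite_preimage => // k l _ _ kl.
    have : [set @psi_nat AA k] (psi_nat k) by [].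
    by rewrite kl => -[].
  rewrite /c; case: pselect => ?; first exact: finite_set1.
  exact: finite_set0.
(* The only member of the cover that contains the point [A] is the basic neighbourhood of [A]. *)
move=> A [_ [[[B ->]|[k ->]] [x [[W VW Wx] Bx]]] //] /psi_basic_set BA.
rewrite {B}BA in Bx.
have [[B WB]|[k Wk]] := VU _ VW.
- rewrite WB in Wx; have FB : (F1 `|` F2) B by left; rewrite /F1 /= -WB.
  (* If the common point belongs to the family, the selected set is the neighbourhood of [A] itself,
     and any element of the cut of [A] will do. *)
  case: x Wx Bx => [C|k] /= => [/psi_basic_set BC /psi_basic_set AC|].
    have [k Ak] := cut_neq0 A.
    by exists k; split=> //; exists B; rewrite // BC -AC.
  by move=> /psi_basic_nat Bk /psi_basic_nat Ak; exists k; split=> //; exists B.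
- move: Wx Bx; rewrite Wk => -> /psi_basic_nat Ak.
  have [B cB Bk] := c_ex _ _ Ak.
  by exists k; split=> //; exists B => //; right; exists k; rewrite //= -Wk.
Qed.

End PsiCovers.

Theorem theorem3p26 (AA : set (set nat)) (hAA : almost_disjoint AA) :
  star_Scheepers (Psi AA) <->
  (forall f : AA -> (nat -> nat),
   exists F : nat -> set AA,
     (forall n, (1 <= n)%N -> finite_set (F n)) /\
     (forall G : set AA, finite_set G ->
      exists n, (1 <= n)%N /\
        forall A : AA, G A ->
          cut (set_val A) (f A n) `&`
          \bigcup_(B in F n) cut (set_val B) (f B n) !=set0)).
Proof.
split=> [SS f|H U Uoc].
  pose U n := cut_cover (fun A : AA => f A n).
  (* Selections are indexed from 0 but the families in (2) from 1, hence the shift by one. *)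
  have [V [VU Vstar]] :=
    SS (fun n => U n.+1) (fun=> cut_cover_open_cover _).
  have /choice[F FP] n : exists F : set AA, finite_set F /\
      forall A, star (\bigcup_(W in V n) W) (U n.+1) (psi_set A) ->
        cut (set_val A) (f A n.+1) `&`
        \bigcup_(B in F) cut (set_val B) (f B n.+1) !=set0.
    have [finV VnU] := VU n.
    by have [F] := cut_cover_star _ _ hAA.1 finV VnU; exists F.
  exists (fun n => F n.-1); split=> [n _|G finG]; first exact: (FP _).1.
  case: Vstar => [[_ Vom]|[n Vn]]; last first.
    by exists n.+1; split=> // A _; apply: (FP n).2; rewrite Vn.
  have [_ [n _ <-] GV] := Vom _ (finite_image psi_set finG).
  by exists n.+1; split=> // A GA; apply: (FP n).2; apply: GV; exists A.
(* [u (n, x)] is a chosen member of the n-th cover around [x]. *)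
have /choice[u uP] (p : nat * Psi AA) : exists W, U p.1 W /\ W p.2.
  have [_ Uc] := Uoc p.1.
  have : cover (U p.1) id p.2 by rewrite Uc.
  by case=> W; exists W.
have /choice[f fP] (p : AA * nat) :
    exists m, psi_basic p.1 `I_m `<=` u (p.2, psi_set p.1).
  have [Un uA] := uP (p.2, psi_set p.1).
  by apply: open_Psi_cut => //; exact: (Uoc p.2).1.
have /choice[F FP] j := H (fun A n => f (A, n + j)).
(* Since [j < n], the index [n - j] is at least 1, where [F j] is known to be finite. The second
   part takes care of the isolated points below [n]. *)
pose V n := [set u (n, psi_set A) | A in \bigcup_(j in `I_n) F j (n - j)] `|`
            [set u (n, psi_nat k) | k in `I_n].
exists V; split=> [n|].
  split; last by move=> W [[A _ <-]|[k _ <-]]; exact: (uP (n, _)).1.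
  rewrite finite_setU; split; apply: finite_image; last exact: finite_II.
  apply: bigcup_finite; first exact: finite_II.
  by move=> j jn; apply: (FP j).1; rewrite subn_gt0.
left; apply: omega_coverP => [_ [n _ <-]|G finG].
  exact/open_star/(Uoc n).1.
have [m Gm] : exists m, psi_nat @^-1` G `<=` `I_m.
  apply: finite_set_nat_bounded; apply: finite_preimage => //.
  by move=> ? ? _ _ [].
have finGA : finite_set (psi_set @^-1` G).
  by apply: finite_preimage => // ? ? _ _ [].
have [i [i_gt0 iP]] := (FP m).2 _ finGA.
(* The shift [m] is among those collected at [i + m] because [i] is positive. *)
have VF B : F m i B -> V (i + m) (u (i + m, psi_set B)).
  move=> FB; left; exists B => //; exists m; last by rewrite addnK.
  by rewrite /= -[ltnLHS]add0n ltn_add2r.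
exists (star (\bigcup_(W in V (i + m)) W) (U (i + m))); first by exists (i + m).
move=> x Gx; have [Ux ux] := uP (i + m, x).
apply: (subset_star _ _ _ _ Ux) ux; case: x Gx {Ux} => [A|k] Gx.
  (* The number [k] lies in both chosen neighbourhoods, that of [A] and that of the selected [B]. *)
  have [k [Ak [B FB Bk]]] := iP A Gx.
  exists (psi_nat k); split; last by apply: (fP (_, _)); right; exists k.
  exists (u (i + m, psi_set B)); first exact: VF.
  by apply: (fP (_, _)); right; exists k.
(* Here [k < m <= i + m], so the neighbourhood of [k] was itself selected. *)
have [_ uk] := uP (i + m, psi_nat k).
exists (psi_nat k); split=> //; exists (u (i + m, psi_nat k)) => //.
right; exists k => //=; exact: leq_trans (Gm _ Gx) (leq_addl _ _).
Qed.
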